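(* Let $b \in \mathbb{N}A$ and let $\tau \subseteq \{1,\dots,n\}$. The group relaxation $G^{\tau}(b)$ of the integer program $IP_{A,c}(b)$ has a finite optimal solution if and only if $\tau$ is a face of the regular triangulation $\Delta_c$.
   Context: $\mathbb{N}$ denotes the non-negative integers. $A \in \mathbb{Z}^{d\times n}$ is a fixed matrix of rank $d$ with columns $a_1,\dots,a_n$; $\mathrm{cone}(A)=\{Au : u\in\mathbb{R}^n, u\ge 0\}$ is pointed and $\{u\in\mathbb{R}^n: Au=0, u\ge 0\}=\{0\}$; $\mathbb{N}A=\{Au: u\in\mathbb{N}^n\}$. For $b\in\mathbb{N}A$, $IP_{A,c}(b)$ is the program $\min\{c\cdot x: Ax=b, x\in\mathbb{N}^n\}$. The cost vector $c\in\mathbb{Z}^n$ is generic, i.e. each $IP_{A,c}(b)$, $b\in\mathbb{N}A$, has a unique optimal solution. Regular triangulation: $\Delta_c$ is the set of all $\sigma\subseteq\{1,\dots,n\}$ for which there exists $y\in\mathbb{R}^d$ with $y\cdot a_j=c_j$ for all $j\in\sigma$ and $y\cdot a_j<c_j$ for all $j\notin\sigma$. Its elements are called faces of $\Delta_c$. (Since $c$ is generic, the cones $\mathrm{cone}(A_\sigma)$, $\sigma\in\Delta_c$, where $A_\sigma$ is the submatrix of columns indexed by $\sigma$, form a complex of simplicial cones with support $\mathrm{cone}(A)$.) Group relaxations: let $B\in\mathbb{Z}^{n\times(n-d)}$ be a matrix whose columns form a basis of the lattice $\mathcal{L}=\{x\in\mathbb{Z}^n: Ax=0\}$ and let $u\in\mathbb{N}^n$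 be a feasible solution of $IP_{A,c}(b)$. Via $x=u-Bz$, $IP_{A,c}(b)$ is equivalent to $\min\{(-cB)\cdot z: Bz\le u, z\in\mathbb{Z}^{n-d}\}$. For $\tau\subseteq\{1,\dots,n\}$ with complement $\bar\tau$, let $B^{\bar\tau}$ be the submatrix of $B$ obtained by deleting the rows indexed by $\tau$ and let $\pi_\tau(u)$ be obtained from $u$ by deleting the coordinates indexed by $\tau$. The group relaxation $G^{\tau}(b)$ of $IP_{A,c}(b)$ with respect to $\tau$ is the program $\min\{(-cB)\cdot z: B^{\bar\tau}z\le\pi_\tau(u), z\in\mathbb{Z}^{n-d}\}$. *)

(* Defs.v *)
From mathcomp Require Import all_boot all_order all_algebra reals.

Set Implicit Arguments.
Unset Strict Implicit.
Unset Printing Implicit Defensive.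

Import Order.TTheory GRing.Theory Num.Theory.
Local Open Scope ring_scope.

(* Integer vectors are columns, and N^n is the set of x : 'cV[int]_n with
   x \is a mxOver Num.nneg. Cost vectors and the dual vectors y are rows, so
   that c . x is (c *m x) 0 0 and y . a_j is (y *m A) 0 j. *)

Definition real_mx (R : realType) (m n : nat) (A : 'M[int]_(m, n)) :
  'M[R]_(m, n) := map_mx intr A.

Definition in_cone (R : realType) (d n : nat) (A : 'M[int]_(d, n))
    (v : 'cV[R]_d) : Prop :=
  exists2 x : 'cV[R]_n, x \is a mxOver Num.nneg & v = real_mx R A *m x.

Definition pointed_cone (R : realType) (d n : nat) (A : 'M[int]_(d, n)) : Prop :=
  forall v : 'cV[R]_d, in_cone A v -> in_cone A (- v) -> v = 0.

Definition no_nonneg_kernel (R : realType) (d n : nat) (A : 'M[int]_(d, n)) :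
  Prop :=
  forall x : 'cV[R]_n, x \is a mxOver Num.nneg -> real_mx R A *m x = 0 -> x = 0.

Definition IP_feasible (d n : nat) (A : 'M[int]_(d, n)) (b : 'cV[int]_d)
    (x : 'cV[int]_n) : Prop :=
  A *m x = b /\ x \is a mxOver Num.nneg.

Definition IP_optimal (d n : nat) (A : 'M[int]_(d, n)) (c : 'rV[int]_n)
    (b : 'cV[int]_d) (x : 'cV[int]_n) : Prop :=
  IP_feasible A b x /\
  forall x' : 'cV[int]_n, IP_feasible A b x' -> (c *m x) 0 0 <= (c *m x') 0 0.

Definition in_NA (d n : nat) (A : 'M[int]_(d, n)) (b : 'cV[int]_d) : Prop :=
  exists2 x : 'cV[int]_n, x \is a mxOver Num.nneg & b = A *m x.

Definition generic_cost (d n : nat) (A : 'M[int]_(d, n)) (c : 'rV[int]_n) :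
  Prop :=
  forall b : 'cV[int]_d, in_NA A b -> exists! x : 'cV[int]_n, IP_optimal A c b x.

Definition regular_triangulation_face (R : realType) (d n : nat)
    (A : 'M[int]_(d, n)) (c : 'rV[int]_n) (sigma : {set 'I_n}) : Prop :=
  exists y : 'rV[R]_d,
    (forall j, j \in sigma -> (y *m real_mx R A) 0 j = (c 0 j)%:~R) /\
    (forall j, j \notin sigma -> (y *m real_mx R A) 0 j < (c 0 j)%:~R).

Definition kernel_lattice_basis (d n k : nat) (A : 'M[int]_(d, n))
    (B : 'M[int]_(n, k)) : Prop :=
  [/\ A *m B = 0,
      forall x : 'cV[int]_n, A *m x = 0 -> exists z : 'cV[int]_k, x = B *m z
    & forall z : 'cV[int]_k, B *m z = 0 -> z = 0].

Definition del_rows (n k : nat) (tau : {set 'I_n}) (M : 'M[int]_(n, k)) :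
  'M[int]_(#|~: tau|, k) :=
  rowsub (fun i : 'I_#|~: tau| => enum_val i) M.

Definition group_feasible (n k : nat) (B : 'M[int]_(n, k)) (u : 'cV[int]_n)
    (tau : {set 'I_n}) (z : 'cV[int]_k) : Prop :=
  forall i : 'I_#|~: tau|, (del_rows tau B *m z) i 0 <= del_rows tau u i 0.

Definition group_optimal (n k : nat) (B : 'M[int]_(n, k)) (c : 'rV[int]_n)
    (u : 'cV[int]_n) (tau : {set 'I_n}) (z : 'cV[int]_k) : Prop :=
  group_feasible B u tau z /\
  forall z' : 'cV[int]_k, group_feasible B u tau z' ->
    (- (c *m B) *m z) 0 0 <= (- (c *m B) *m z') 0 0.

(* Main.v *)
Require Import Defs.
From mathcomp Require Import all_boot all_order all_algebra reals.
From mathcomp Require Import boolp zify.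

Set Implicit Arguments.
Unset Strict Implicit.
Unset Printing Implicit Defensive.

Import Order.TTheory GRing.Theory Num.Theory.
Local Open Scope ring_scope.

(** Substituting [x = u - B z] turns the group relaxation into the problem of
    minimising [c x] over the [x] of the coset [u + ker A] (in Z^n) that are
    nonnegative off [tau].

    If [y] exhibits [tau] as a face, the reduced cost [c - y A] vanishes on
    [tau] and is positive off it, so [c x = y b + (c - y A) x >= y b] for such
    [x].  The objective is integer valued, bounded below, and [z = 0] is
    feasible, hence the minimum is attained.

    Conversely, an optimal solution forbids integer directions [w] of [ker A]
    that are nonnegative off [tau] and have [c w < 0], since moving along [w]
    would improve the objective.  Clearing denominators forbids the rational
    ones as well, and Farkas' lemma over the rationals ([farkas_kernel])
    provides [y] with [y A = c] on [tau] and [y A <= c] off [tau].  What is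
    missing is strictness off [tau].  Let [sigma], containing [tau], be the set
    where [y A = c].  The columns of [A] in [sigma] are linearly independent
    ([generic_tight_kernel]): the positive and negative parts of an integer
    relation among them are two optimal solutions of the same integer program,
    which genericity makes equal.  Therefore [y] can be moved in a direction
    that lowers [y A] on [sigma] minus [tau] and keeps it on [tau]; a short
    step preserves the strict inequalities off [sigma]. *)

(** * Farkas' lemma on a kernel *)

Lemma not_submx_kernel_vector (F : realFieldType) (d n : nat) (A : 'M[F]_(d, n))
    (g : 'rV[F]_n) :
  ~~ (g <= A)%MS -> exists2 w : 'cV[F]_n, A *m w = 0 & 0 < (g *m w) 0 0.
Proof.
rewrite submxE => /rowV0Pn[_ /sub_rVP[a ->]].
rewrite scaler_eq0 negb_or => /andP[_ /matrix0Pn[i [j]]].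
rewrite (ord1 i); have := mulmx_coker A; move: (cokermx A) => N AN0 gj0.
exists ((g *m N) 0 j *: col j N).
  by rewrite -scalemxAr colE mulmxA AN0 mul0mx scaler0.
rewrite -scalemxAr colE mulmxA -colE mxE [col _ _ _ _]mxE.
by rewrite -expr2 exprn_even_gt0.
Qed.

(** Bartl's induction on the number of inequalities: a point [x] that separates
    [g] from all inequalities but the first one, [h], is used to project
    everything onto the hyperplane [h = 0], where [h] disappears. *)
Lemma farkas_kernel (F : realFieldType) (d n m : nat) (A : 'M[F]_(d, n))
    (G : 'M[F]_(m, n)) (g : 'rV[F]_n) :
  (exists2 v : 'rV[F]_m, v \is a mxOver Num.nneg & (g - v *m G <= A)%MS) \/
  (exists w : 'cV[F]_n,
     [/\ A *m w = 0, forall i, (G *m w) i 0 <= 0 & 0 < (g *m w) 0 0]).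
Proof.
elim: m => [|m IH] in G g *.
  have [gA|/not_submx_kernel_vector[w Aw gw]] := boolP (g <= A)%MS.
    by left; exists 0; rewrite ?mul0mx ?subr0 //; apply/mxOverP => ? [].
  by right; exists w; split => // -[].
rewrite -[m.+1]/(1 + m)%N in G *.
rewrite -(vsubmxK G); set h := usubmx G; set H := dsubmx G.
have [[v v0 gv]|[x [Ax Hx gx]]] := IH H g.
  left; exists (row_mx 0 v); last by rewrite mul_row_col mul0mx add0r.
  apply/mxOverP => i j; rewrite mxE; case: split => k; last exact: (mxOverP v0).
  by rewrite mxE rpred0.
have [hx|hx] := lerP ((h *m x) 0 0) 0.
  right; exists x; split => // i; rewrite mul_col_mx mxE.
  by case: split => k //; rewrite (ord1 k).
(* Rescaling makes [h x = 1], so that [id - x h] is the projection. *)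
wlog hx1 : x Ax Hx gx hx / h *m x = 1%:M => [hwlog|].
  pose t := (h *m x) 0 0.
  have t0 : 0 < t^-1 by rewrite invr_gt0.
  apply: (hwlog (t^-1 *: x)) => [|i|||]; rewrite -scalemxAr.
  - by rewrite Ax scaler0.
  - by rewrite mxE mulr_ge0_le0 // ltW.
  - by rewrite mxE mulr_gt0.
  - by rewrite mxE mulr_gt0.
  - by rewrite [h *m x]mx11_scalar scale_scalar_mx mulVf ?gt_eqF.
have [[v v0 gv]|[w [Aw Hw gw]]] := IH (H - H *m x *m h) (g - g *m x *m h).
  left; exists (row_mx (g *m x - v *m H *m x) v); last first.
    move: gv; rewrite mul_row_col mulmxBr mulmxBl !mulmxA -addrA -opprD.
    by rewrite [in X in _ -> X]addrAC addrA.
  apply/mxOverP => i j; rewrite mxE; case: split => k; last exact: (mxOverP v0).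
  rewrite (ord1 i) (ord1 k) nnegrE.
  have -> : (g *m x - v *m H *m x) 0 0 = (g *m x) 0 0 - (v *m H *m x) 0 0.
    by rewrite !mxE.
  rewrite subr_ge0.
  apply: le_trans (ltW gx); rewrite -mulmxA mxE sumr_le0 // => l _.
  by rewrite mulr_ge0_le0 // -nnegrE (mxOverP v0).
right; exists (w - x *m (h *m w)); split.
- by rewrite mulmxBr Aw !mulmxA Ax !mul0mx subrr.
- move=> i; rewrite mul_col_mx mxE; case: split => k.
    by rewrite mulmxBr !mulmxA hx1 mul1mx subrr mxE.
  by have := Hw k; rewrite mulmxBr mulmxBl !mulmxA.
- by move: gw; rewrite mulmxBr mulmxBl !mulmxA.
Qed.

(** * Clearing denominators and attaining integer minima *)

Lemma clear_denominators (n : nat) (w : 'cV[rat]_n) :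
  exists2 k : int, 0 < k & exists W : 'cV[int]_n, map_mx intr W = k%:~R *: w.
Proof.
exists (\prod_i denq (w i 0)); first by apply: prodr_gt0 => i _; apply: denq_gt0.
exists (\col_i (numq (w i 0) * \prod_(j | j != i) denq (w j 0))).
apply/matrixP => i j; rewrite !mxE (ord1 j) [in RHS](bigD1 i) //=.
by rewrite !rmorphM /= numqE [RHS]mulrC [RHS]mulrA.
Qed.

Lemma kernel_clear_denominators (d n : nat) (A : 'M[int]_(d, n))
    (w : 'cV[rat]_n) :
  map_mx intr A *m w = 0 ->
  exists2 k : int, 0 < k &
    exists2 W : 'cV[int]_n, A *m W = 0 & map_mx intr W = k%:~R *: w.
Proof.
move=> Aw; have [k k0 [W WE]] := clear_denominators w.
exists k => //; exists W => //.
have : map_mx intr (A *m W) = 0 :> 'cV[rat]_d.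
  by rewrite map_mxM WE -scalemxAr Aw scaler0.
move/matrixP => AW; apply/matrixP => i j; have := AW i j.
rewrite [LHS]mxE [RHS]mxE => /eqP; rewrite intr_eq0 => /eqP ->.
by rewrite mxE.
Qed.

(** The value [f x - lo] is a natural number, so descent terminates. *)
Lemma int_min_attained (T : Type) (P : T -> Prop) (f : T -> int) (lo : int)
    (x0 : T) :
  P x0 -> (forall x, P x -> lo <= f x) ->
  exists x, P x /\ forall x', P x' -> f x <= f x'.
Proof.
move=> Px0 flo; have [k] := ubnP `|f x0 - lo|%N.
elim: k => // k IH in x0 Px0 *; rewrite ltnS => fk.
have [[x Px fx]|xmin] := pselect (exists2 x, P x & f x < f x0).
  apply: (IH x Px); have := flo _ Px; have := flo _ Px0; lia.
exists x0; split=> // x Px; rewrite leNgt; apply/negP => fx.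
by apply: xmin; exists x.
Qed.

(** * Reduced costs and integer programs *)

Lemma reduced_cost_objective (F : realFieldType) (d n : nat)
    (A : 'M[int]_(d, n)) (c : 'rV[int]_n) (y : 'rV[F]_d) (x : 'cV[int]_n) :
  ((c *m x) 0 0)%:~R = (y *m map_mx intr (A *m x)) 0 0
    + \sum_j ((c 0 j)%:~R - (y *m map_mx intr A) 0 j) * (x j 0)%:~R :> F.
Proof.
rewrite map_mxM mulmxA !mxE rmorph_sum -big_split /=; apply: eq_bigr => j _.
by rewrite rmorphM /= [map_mx _ _ j 0]mxE mulrBl addrC subrK.
Qed.

(** Complementary slackness: the reduced cost term of the objective is [0] at
    [x] and nonnegative at every other feasible point. *)
Lemma tight_support_optimal (F : realFieldType) (d n : nat)
    (A : 'M[int]_(d, n)) (c : 'rV[int]_n) (y : 'rV[F]_d) (x : 'cV[int]_n) :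
  (forall j, (y *m map_mx intr A) 0 j <= (c 0 j)%:~R) ->
  x \is a mxOver Num.nneg ->
  (forall j, x j 0 != 0 -> (y *m map_mx intr A) 0 j = (c 0 j)%:~R) ->
  IP_optimal A c (A *m x) x.
Proof.
move=> yc x0 ytight; split=> // x' [Ax' x'0].
rewrite -(ler_int F) !(reduced_cost_objective A c y) Ax' lerD2l big1 => [|j _].
  apply: sumr_ge0 => j _; rewrite mulr_ge0 ?subr_ge0 // ler0z.
  by rewrite -nnegrE (mxOverP x'0).
have [->|/ytight->] := eqVneq (x j 0) 0; first by rewrite mulr0.
by rewrite subrr mul0r.
Qed.

(** The positive and negative parts of a relation [w] have the same image under
    [A] and tight support, so both are the optimal solution of one program. *)
Lemma generic_tight_kernel (F : realFieldType) (d n : nat)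
    (A : 'M[int]_(d, n)) (c : 'rV[int]_n) (y : 'rV[F]_d) (w : 'cV[int]_n) :
  generic_cost A c ->
  (forall j, (y *m map_mx intr A) 0 j <= (c 0 j)%:~R) ->
  (forall j, w j 0 != 0 -> (y *m map_mx intr A) 0 j = (c 0 j)%:~R) ->
  A *m w = 0 -> w = 0.
Proof.
move=> c_generic yc ytight Aw.
pose part s := map_mx (fun a : int => Num.max (s * a) 0) w.
have part_nneg s : part s \is a mxOver Num.nneg.
  by apply/mxOverP => i j; rewrite mxE nnegrE le_max lexx orbT.
have part_opt s : IP_optimal A c (A *m part s) (part s).
  apply: (tight_support_optimal yc) => // j; rewrite mxE => pj; apply: ytight.
  by apply: contra_neq pj => ->; rewrite mulr0 maxxx.
have wE : w = part 1 - part (-1).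
  by apply/matrixP => i j; rewrite !mxE; lia.
have AE : A *m part (-1) = A *m part 1.
  by apply/eqP; rewrite eq_sym -subr_eq0 -mulmxBr -wE Aw.
have [|x [_ xuniq]] := c_generic (A *m part 1); first by exists (part 1).
rewrite wE -(xuniq _ (part_opt 1)) -(xuniq (part (-1))) ?subrr //.
by rewrite -AE; apply: part_opt.
Qed.

(** Dual form of injectivity, with [D] the coordinate projection onto [sigma]:
    if [A D N = 0], the columns of [D N] are relations supported in [sigma], so
    [D N = 0].  For [N] the cokernel of [A D], this puts [t D] in the row space
    of [A D]. *)
Lemma row_prescribed_on (F : fieldType) (d n : nat) (A : 'M[F]_(d, n))
    (sigma : {set 'I_n}) (t : 'rV[F]_n) :
  (forall w : 'cV[F]_n, (forall j, j \notin sigma -> w j 0 = 0) ->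
     A *m w = 0 -> w = 0) ->
  exists p : 'rV[F]_d, forall j, j \in sigma -> (p *m A) 0 j = t 0 j.
Proof.
move=> Ainj; pose D : 'M[F]_n := diag_mx (\row_j (j \in sigma)%:R).
have DE m (M : 'M[F]_(m, n)) i j : (M *m D) i j = M i j * (j \in sigma)%:R.
  by rewrite mul_mx_diag !mxE.
have [p pE] : exists p, t *m D = p *m (A *m D).
  apply/submxP; rewrite submxE -mulmxA.
  have : A *m D *m cokermx (A *m D) = 0 by apply: mulmx_coker.
  move: (cokermx _) => N; rewrite -mulmxA => ADN.
  suff -> : D *m N = 0 by rewrite mulmx0.
  apply/matrixP => i k; have /matrixP/(_ i 0) : col k (D *m N) = 0.
    apply: Ainj => [j jsigma|].
      by rewrite mxE mul_diag_mx !mxE (negPf jsigma) mul0r.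
    by rewrite colE mulmxA ADN mul0mx.
  by rewrite !mxE.
exists p => j jsigma; have /matrixP/(_ 0 j) := pE.
by rewrite mulmxA !DE jsigma !mulr1.
Qed.

(** Moving [y] in a direction [p] with [p A = -1] on the tight columns outside
    [tau] and [p A = 0] on [tau] makes exactly the columns of [tau] tight. *)
Lemma generic_strict_dual (d n : nat) (A : 'M[int]_(d, n)) (c : 'rV[int]_n)
    (tau : {set 'I_n}) (y : 'rV[rat]_d) :
  generic_cost A c ->
  (forall j, (y *m map_mx intr A) 0 j <= (c 0 j)%:~R) ->
  (forall j, j \in tau -> (y *m map_mx intr A) 0 j = (c 0 j)%:~R) ->
  exists y' : 'rV[rat]_d,
    (forall j, j \in tau -> (y' *m map_mx intr A) 0 j = (c 0 j)%:~R) /\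
    (forall j, j \notin tau -> (y' *m map_mx intr A) 0 j < (c 0 j)%:~R).
Proof.
move=> c_generic yc ytau; set AQ : 'M[rat]_(d, n) := map_mx intr A in yc ytau *.
pose slack j := (c 0 j)%:~R - (y *m AQ) 0 j.
have slack_ge0 j : 0 <= slack j by rewrite subr_ge0.
pose sigma := [set j | slack j == 0].
have [|p pE] := @row_prescribed_on _ _ _ AQ sigma (\row_j - (j \notin tau)%:R).
  move=> w wsigma /kernel_clear_denominators[k k0 [W AW WE]].
  have kQ0 : k%:~R != 0 :> rat by rewrite intr_eq0 gt_eqF.
  suff W0 : W = 0.
    by move/esym/eqP: WE; rewrite W0 map_mx0 scaler_eq0 (negPf kQ0) => /eqP.
  apply: (generic_tight_kernel c_generic yc _ AW) => j Wj0.
  apply/eqP; rewrite eq_sym -subr_eq0; apply: contraNT Wj0 => sj0.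
  have /matrixP/(_ j 0) := WE; rewrite !mxE wsigma ?inE // mulr0.
  by move/eqP; rewrite intr_eq0.
have {}pE j : slack j = 0 -> (p *m AQ) 0 j = - (j \notin tau)%:R.
  by move=> sj0; rewrite pE ?inE ?sj0 // mxE.
(* Off [sigma], [eps * `|(p AQ) 0 j| < slack j], since the denominator exceeds
   its own [j]-th summand; on [sigma] the summands are divisions by zero, hence
   [0]. *)
pose eps := (1 + \sum_j `|(p *m AQ) 0 j| / slack j)^-1.
have sum_ge0 : 0 <= \sum_j `|(p *m AQ) 0 j| / slack j.
  by apply: sumr_ge0 => j _; rewrite divr_ge0.
have eps_gt0 : 0 < eps by rewrite invr_gt0 ltr_wpDr.
exists (y + eps *: p); rewrite mulmxDl -scalemxAl.
have yE j : (y *m AQ + eps *: (p *m AQ)) 0 j =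
    (y *m AQ) 0 j + eps * (p *m AQ) 0 j.
  by rewrite mxE; congr (_ + _); rewrite mxE.
split=> j jtau; rewrite yE.
  by rewrite pE /slack ytau ?subrr // jtau oppr0 mulr0 addr0.
rewrite addrC -ltrBrDr -/(slack j).
have [sj0|sj0] := eqVneq (slack j) 0.
  by rewrite sj0 pE // jtau mulrN1 oppr_lt0.
have sj_gt0 : 0 < slack j by rewrite lt_def sj0 slack_ge0.
rewrite /eps mulrC ltr_pdivrMr ?ltr_wpDr // (le_lt_trans (ler_norm _)) //.
rewrite mulrC -ltr_pdivrMr // (bigD1 j) //= addrCA ltrDl ltr_wpDr //.
by apply: sumr_ge0 => k _; rewrite divr_ge0.
Qed.

Lemma rational_face (R : realType) (d n : nat) (A : 'M[int]_(d, n))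
    (c : 'rV[int]_n) (tau : {set 'I_n}) (y : 'rV[rat]_d) :
  (forall j, j \in tau -> (y *m map_mx intr A) 0 j = (c 0 j)%:~R) ->
  (forall j, j \notin tau -> (y *m map_mx intr A) 0 j < (c 0 j)%:~R) ->
  regular_triangulation_face R A c tau.
Proof.
move=> ytau ylt; exists (map_mx ratr y).
have yE j : (map_mx ratr y *m real_mx R A) 0 j =
    ratr ((y *m map_mx intr A) 0 j).
  rewrite !mxE rmorph_sum; apply: eq_bigr => i _.
  by rewrite !mxE rmorphM /= ratr_int.
split=> j jtau; rewrite yE; first by rewrite ytau // ratr_int.
by rewrite -(ratr_int R) ltr_rat ylt.
Qed.

(** * The group relaxation *)

Lemma group_feasibleE (n k : nat) (B : 'M[int]_(n, k)) (u : 'cV[int]_n)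
    (tau : {set 'I_n}) (z : 'cV[int]_k) :
  group_feasible B u tau z <->
  (forall j, j \notin tau -> 0 <= (u - B *m z) j 0).
Proof.
have delE i : ((del_rows tau B *m z) i 0 <= del_rows tau u i 0) =
    (0 <= (u - B *m z) (enum_val i) 0).
  by rewrite /del_rows mul_rowsub_mx !mxE subr_ge0.
split=> [zfeas j jtau|zfeas i].
  have jC : j \in ~: tau by rewrite inE.
  by rewrite -(enum_rankK_in jC jC) -delE.
by rewrite delE zfeas // -in_setC enum_valP.
Qed.

Lemma group_objectiveE (n k : nat) (B : 'M[int]_(n, k)) (c : 'rV[int]_n)
    (u : 'cV[int]_n) (z : 'cV[int]_k) :
  (- (c *m B) *m z) 0 0 = (c *m (u - B *m z)) 0 0 - (c *m u) 0 0.
Proof.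
rewrite mulmxBr mulNmx mulmxA; move: (c *m u) (c *m B *m z) => s t.
by rewrite !mxE addrAC subrr add0r.
Qed.

(** The objective is an integer bounded below by [y A u - c u], and [u >= 0]
    makes [z = 0] feasible. *)
Lemma face_group_optimal (R : realType) (d n k : nat) (A : 'M[int]_(d, n))
    (c : 'rV[int]_n) (B : 'M[int]_(n, k)) (u : 'cV[int]_n) (tau : {set 'I_n}) :
  A *m B = 0 -> u \is a mxOver Num.nneg ->
  regular_triangulation_face R A c tau ->
  exists z : 'cV[int]_k, group_optimal B c u tau z.
Proof.
move=> AB u0 [y [ytau ylt]].
pose lo := Num.floor ((y *m map_mx intr (A *m u)) 0 0) - (c *m u) 0 0.
apply: (@int_min_attained _ (group_feasible B u tau)
  (fun z => (- (c *m B) *m z) 0 0) lo 0) => [|z].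
  by apply/group_feasibleE => j _; rewrite mulmx0 subr0 -nnegrE (mxOverP u0).
move=> /group_feasibleE zfeas; rewrite (group_objectiveE B c u) lerD2r.
rewrite -(ler_int R) (le_trans (ge_floor _)) //.
rewrite (reduced_cost_objective A c y) mulmxBr mulmxA AB mul0mx subr0 lerDl.
apply: sumr_ge0 => j _; have [jtau|jtau] := boolP (j \in tau).
  by rewrite -[map_mx _ _]/(real_mx R A) ytau // subrr mul0r.
by rewrite mulr_ge0 // ?ler0z ?zfeas // subr_ge0 ltW // ylt.
Qed.

(** Otherwise a step along [w] from the optimal solution would improve it. *)
Lemma group_optimal_direction (d n k : nat) (A : 'M[int]_(d, n))
    (c : 'rV[int]_n) (B : 'M[int]_(n, k)) (u : 'cV[int]_n) (tau : {set 'I_n})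
    (z : 'cV[int]_k) (w : 'cV[int]_n) :
  kernel_lattice_basis A B -> group_optimal B c u tau z -> A *m w = 0 ->
  (forall j, j \notin tau -> 0 <= w j 0) -> 0 <= (c *m w) 0 0.
Proof.
move=> [_ Bgen _] [/group_feasibleE zfeas zopt] /Bgen[t wE] w0.
have ztE : u - B *m (z - t) = u - B *m z + w.
  by rewrite mulmxBr -wE opprB addrA addrAC.
have addE (p q : 'M[int]_1) : (p + q) 0 0 = p 0 0 + q 0 0 by rewrite mxE.
have := zopt (z - t); rewrite !(group_objectiveE B c u) lerD2r ztE.
rewrite [c *m (_ + w)]mulmxDr addE lerDl; apply; apply/group_feasibleE => j jtau.
by rewrite ztE mxE addr_ge0 ?zfeas ?w0.
Qed.

(** Linear programming duality: Farkas' lemma for [- c] on [ker A], with the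
    inequalities [- w_j <= 0] for [j] off [tau]. *)
Lemma group_optimal_dual (d n k : nat) (A : 'M[int]_(d, n))
    (c : 'rV[int]_n) (B : 'M[int]_(n, k)) (u : 'cV[int]_n) (tau : {set 'I_n})
    (z : 'cV[int]_k) :
  kernel_lattice_basis A B -> group_optimal B c u tau z ->
  exists y : 'rV[rat]_d,
    (forall j, (y *m map_mx intr A) 0 j <= (c 0 j)%:~R) /\
    (forall j, j \in tau -> (y *m map_mx intr A) 0 j = (c 0 j)%:~R).
Proof.
move=> basisB zopt.
pose G : 'M[rat]_n := diag_mx (\row_j - (j \notin tau)%:R).
have [[v v0 /submxP[y yE]]|[w [Aw Gw cw]]] :=
    farkas_kernel (map_mx intr A) G (- map_mx intr c).
  have yAE j : (- y *m map_mx intr A) 0 j =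
      (c 0 j)%:~R - v 0 j * (j \notin tau)%:R.
    by rewrite mulNmx -yE mul_mx_diag !mxE mulrN opprB opprK addrC.
  exists (- y); split=> j => [|jtau]; rewrite yAE.
    by rewrite gerBl mulr_ge0 // -nnegrE (mxOverP v0).
  by rewrite jtau mulr0 subr0.
have [l l0 [W AW WE]] := kernel_clear_denominators Aw.
have lQ0 : 0 < l%:~R :> rat by rewrite ltr0z.
have W0 j : j \notin tau -> 0 <= W j 0.
  move=> jtau; have /matrixP/(_ j 0) := WE; rewrite !mxE -(ler0z rat) => ->.
  have := Gw j; rewrite mul_diag_mx !mxE jtau mulN1r oppr_le0 => wj0.
  by rewrite mulr_ge0 // ltW.
have := group_optimal_direction basisB zopt AW W0.
rewrite -(ler0z rat) leNgt => /negP[].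
have -> : ((c *m W) 0 0)%:~R = (map_mx intr c *m map_mx intr W) 0 0 :> rat.
  by rewrite -map_mxM [RHS]mxE.
rewrite WE -scalemxAr mxE pmulr_rlt0 // -oppr_gt0.
by move: cw; rewrite mulNmx mxE.
Qed.

Theorem theorem2p8 (R : realType) (d n : nat) (A : 'M[int]_(d, n))
    (rankA : \rank (real_mx R A) = d)
    (pointedA : pointed_cone R A)
    (kerA : no_nonneg_kernel R A)
    (c : 'rV[int]_n) (c_generic : generic_cost A c)
    (B : 'M[int]_(n, n - d)) (basisB : kernel_lattice_basis A B)
    (b : 'cV[int]_d) (b_NA : in_NA A b)
    (u : 'cV[int]_n) (u_feasible : IP_feasible A b u)
    (tau : {set 'I_n}) :
  (exists z : 'cV[int]_(n - d), group_optimal B c u tau z) <->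
  regular_triangulation_face R A c tau.
Proof.
split=> [[z zopt]|tau_face].
  have [y [yc ytau]] := group_optimal_dual basisB zopt.
  have [y' [y'tau y'lt]] := generic_strict_dual c_generic yc ytau.
  exact: rational_face y'tau y'lt.
have [AB _ _] := basisB; have [_ u0] := u_feasible.
exact: face_group_optimal AB u0 tau_face.
Qed.
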